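(* Any data structure of size $\tilde{\mathcal{O}}(n)$ for maintaining a longest common substring of a dynamic string $S$ (undergoing single-letter substitutions) and a static string $T$, each of length at most $n$, requires $\Omega(\log n/\log\log n)$ time per update operation.
   Context: $\tilde{\mathcal{O}}(n)$ means $n\cdot\log^{\mathcal{O}(1)} n$. A longest common substring of two strings is a longest string occurring as a substring of both. The lower bound is for data structures in the cell-probe/word-RAM model with words of $\Theta(\log n)$ bits. *)

(* Defs.v *)
From mathcomp Require Import all_boot.
Set Implicit Arguments. Unset Strict Implicit. Unset Printing Implicit Defensive.

Definition common_at (S T : seq nat) (i j l : nat) : bool :=
  [&& i + l <= size S, j + l <= size T & take l (drop i S) == take l (drop j T)].

Definition is_lcs (S T : seq nat) (o : nat * nat * nat) : Prop :=
  let: (i, j, l) := o in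
  common_at S T i j l /\ (forall i' j' l', common_at S T i' j' l' -> l' <= l).

(* An operation is an adaptive decision tree over memory cells: it reads a
   cell (its address chosen adaptively) and branches on its content, writes a
   value into a cell, or stops with an output. Every read/write is a probe. *)
Inductive prog (O : Type) : Type :=
| Ret : O -> prog O
| Read : nat -> (nat -> prog O) -> prog O
| Write : nat -> nat -> prog O -> prog O.

Fixpoint exec (O : Type) (w s : nat) (p : prog O) (m : nat -> nat)
  : option (O * (nat -> nat) * nat) :=
  match p with
  | Ret o => Some (o, m, 0)
  | Read a k =>
      if a < s then
        match exec w s (k (m a)) m with
        | Some (o, m', c) => Some (o, m', c.+1)
        | None => None
        end
      else None
  | Write a v p' =>
      if a < s then
        match exec w s p' (fun b => if b == a then v %% 2 ^ w else m b) with
        | Some (o, m', c) => Some (o, m', c.+1)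
        | None => None
        end
      else None
  end.

(* A data structure for dynamic LCS: preprocessing (free, arbitrary, as is
   standard in the cell-probe model) builds the initial memory from the
   initial S and the static T; the update "S[i] := a" is a decision tree which
   must output a longest common substring of the updated S and T. *)
Record lcs_ds : Type := LcsDS {
  ds_init : seq nat -> seq nat -> (nat -> nat);
  ds_update : nat -> nat -> prog (nat * nat * nat)
}.

Fixpoint serves (D : lcs_ds) (w s t : nat) (T S : seq nat) (m : nat -> nat)
  (ops : seq (nat * nat)) : Prop :=
  match ops with
  | [::] => True
  | (i, a) :: ops' =>
      i < size S -> a < 2 ^ w ->
      match exec w s (ds_update D i a) m with
      | Some (o, m', c) =>
          c <= t /\ is_lcs (set_nth 0 S i a) T o /\
          serves D w s t T (set_nth 0 S i a) m' ops'
      | None => False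
      end
  end.

Definition correct_ds (D : lcs_ds) (n w s t : nat) : Prop :=
  forall S T : seq nat,
    size S <= n -> size T <= n ->
    all (fun x => x < 2 ^ w) S -> all (fun x => x < 2 ^ w) T ->
    (forall a, ds_init D S T a < 2 ^ w) /\
    forall ops, serves D w s t T S (ds_init D S T) ops.

(* Main.v *)
Require Import Defs.
From mathcomp Require Import all_boot all_fingroup zify.
Set Implicit Arguments. Unset Strict Implicit. Unset Printing Implicit Defensive.

(** Fix words over [B] digits of length [d], and take [A = B ^ d] independent
    copies of the [B]-ary butterfly of depth [d], where the path from [u] to [v]
    visits at level [i] the word [v_0 .. v_(i-1) u_i .. u_(d-1)].  A set [y] of
    forbidden edges is written in [T], the edge of copy [a] leaving [z] at level
    [i] with digit [b] being the string [z_i .. z_(d-1) #_a z_0 .. z_(i-1) b].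
    The text [S] is fixed and holds a block [u % v] for all pairs; substituting
    [#_a] for [%] in one block makes the LCS have length [d + 2] iff the path
    from [u] to [v] in copy [a] uses an edge of [y].  So one update answers a
    butterfly reachability query, on a data structure of size quasi-linear in
    the number [k = A * B ^ d] of sources.

    Reachability is bounded from below by the richness method (Miltersen et al.,
    Patrascu): choosing a permutation of the [B] digits in each of the complete
    bipartite subgraphs of the butterflies routes all [k] sources at once along
    [k] edge-disjoint paths.  The [k (t + 1)] cells which include all cells
    probed by these [k] queries can be described with [O(k t log log n)] bits,
    whereas the permutations carry about [k d log B] bits; hence a cell
    set compatible with many routings covers many edges, and its contents are
    too few bits to certify that [y] avoids all of them.  With [B] polylogarithmic this forces
    [t] to be of order [d = Theta(log n / log log n)]. *)

(** * Cell probes *)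

(* Only the reads: written values are known without access to the memory. *)
Fixpoint probes (O : Type) (w : nat) (p : prog O) (m : nat -> nat) : seq nat :=
  match p with
  | Ret _ => [::]
  | Read a k => a :: probes w (k (m a)) m
  | Write a v p' => probes w p' (fun b => if b == a then v %% 2 ^ w else m b)
  end.

Definition output (O : Type) (w s : nat) (p : prog O) (m : nat -> nat) : option O :=
  omap (fun r => r.1.1) (exec w s p m).

Lemma probes_bound (O : Type) w s (p : prog O) m o m' c :
  exec w s p m = Some (o, m', c) ->
  size (probes w p m) <= c /\ {in probes w p m, forall a, a < s}.
Proof.
elim: p m o m' c => [o'|a k IH|a v p' IH] m o m' c //=.
- case: ifP => // lt_as; case E: exec => [[[o1 m1] c1]|] // [_ _ <-].
  have [sz lts] := IH _ _ _ _ _ E; split=> // b; rewrite inE => /orP[/eqP->|/lts] //.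
- case: ifP => // _; case E: exec => [[[o1 m1] c1]|] // [_ _ <-].
  by have [sz lts] := IH _ _ _ _ E; split=> //; apply: leqW.
Qed.

(** Equal contents of the probed cells send both runs down the same branches, and both store the
    same values. *)
Lemma output_local (O : Type) w s (p : prog O) m1 m2 :
  {in probes w p m1, m1 =1 m2} ->
  probes w p m2 = probes w p m1 /\ output w s p m2 = output w s p m1.
Proof.
rewrite /output; elim: p m1 m2 => [o|a k IH|a v p' IH] m1 m2 //= eqm.
- have eqa : m2 a = m1 a by rewrite eqm ?mem_head.
  rewrite eqa; have [|-> ] := IH (m1 a) m1 m2.
    by move=> b pb; apply: eqm; rewrite inE pb orbT.
  case: ifP => // _.
  by case: exec => [[[? ?] ?]|]; case: exec => [[[? ?] ?]|] //= [->].
- have [|-> ] := IH (fun b => if b == a then v %% 2 ^ w else m1 b)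
                    (fun b => if b == a then v %% 2 ^ w else m2 b).
    by move=> b pb; rewrite (eqm b pb).
  case: ifP => // _.
  by case: exec => [[[? ?] ?]|]; case: exec => [[[? ?] ?]|] //= [->].
Qed.

(** * Counting *)

(* Via [q ^ q <= (2 q) ^_ q = 'C(2 q, q) * q`!]. *)
Lemma expnn_le_fact q : q ^ q <= 4 ^ q * q`!.
Proof.
have Hf : q ^ q <= (q + q) ^_ q.
  rewrite ffact_prod -[X in _ ^ X]card_ord -prod_nat_const.
  by apply: leq_prod => i _; have := ltn_ord i; lia.
apply: (leq_trans Hf); rewrite -bin_ffact leq_mul2r; apply/orP; right.
have -> : 4 ^ q = (1 + 1) ^ (q + q) by rewrite -[4]/((1 + 1) ^ 2) -expnM mul2n -addnn.
by rewrite expnDn (bigD1 (inord q)) //= !exp1n inordK ?muln1 ?leq_addr; lia.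
Qed.

(** The falling factorial is at most [(q * 2 ^ lam) ^ q]; dividing by the factorial of [q] cancels
    [q ^ q] up to [4 ^ q]. *)
Lemma binomial_le_expn s q lam : s + q <= q * 2 ^ lam -> 0 < q ->
  'C(s + q, q) <= 2 ^ ((lam + 2) * q).
Proof.
move=> le_sq q_gt0; have qq_gt0 : 0 < q ^ q by rewrite expn_gt0 q_gt0.
rewrite -(leq_pmul2r qq_gt0); apply: (leq_trans (leq_mul (leqnn _) (expnn_le_fact q))).
rewrite mulnCA bin_ffact.
have le_ff : (s + q) ^_ q <= (s + q) ^ q.
  rewrite ffact_prod -[X in _ <= _ ^ X]card_ord -prod_nat_const.
  by apply: leq_prod => i _; lia.
apply: (leq_trans (leq_mul (leqnn _) le_ff)).
rewrite -expnMn expnM -expnMn leq_exp2r //.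
by rewrite expnD; lia.
Qed.

Lemma superset_card (T : finType) (P : {set T}) q : #|P| <= q -> q <= #|T| ->
  exists Q : {set T}, P \subset Q /\ #|Q| = q.
Proof.
move=> + le_qT; elim: q le_qT => [|q IH] le_qT.
  by move=> P0; exists P; split=> //; lia.
rewrite leq_eqVlt => /orP[/eqP cP|ltP]; first by exists P.
have [|Q [sPQ cQ]] := IH _ ltP; first exact: ltnW.
have /set0Pn[e] : ~: Q != set0 by rewrite -card_gt0 cardsCs setCK subn_gt0 cQ.
rewrite inE => eQ; exists (e |: Q); split; last by rewrite cardsU1 eQ cQ.
exact: subset_trans sPQ (subsetUr _ _).
Qed.

Lemma leq_card_fibres (T C : finType) (f : T -> C) (A : {set T}) n :
  (forall x, x \in A -> #|[set y in A | f y == f x]| <= n) -> #|A| <= #|C| * n.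
Proof.
move=> fib; rewrite -sum1_card (partition_big f xpredT) //= -sum_nat_const.
apply: leq_sum => c _; rewrite sum1dep_card.
have [->|[x]] := set_0Vmem [set y in A | f y == c]; first by rewrite cards0.
by rewrite inE => /andP[xA /eqP <-]; apply: fib.
Qed.

Lemma card_disjoint_sets (E : finType) (F : {set E}) :
  #|[set y : {set E} | [disjoint F & y]]| = 2 ^ (#|E| - #|F|).
Proof.
rewrite -(cardsC F) addKn -card_powerset; apply: eq_card => y.
by rewrite !inE disjoint_sym disjoints_subset.
Qed.

(* [good x y Q] reads: on the memory built from [y], all queries of [x] accept and
   probe only [Q].  For fixed [Q] and fixed contents of [Q] the good pairs form a
   rectangle, all of whose [y] avoid every edge used by its [x]; either these
   edges are at most [E0], and few [x] occur, or they are more, and few [y] occur. *)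
Lemma richness (E X W : finType) (N q l E0 b : nat) (Es : X -> {set E})
    (cell : {set E} -> 'I_N -> W) (good : X -> {set E} -> {set 'I_N} -> bool) :
  (forall x, #|Es x| = l) ->
  (forall F : {set E}, #|F| <= E0 -> #|[set x | Es x \subset F]| <= b) ->
  (forall x (y : {set E}), [disjoint Es x & y] ->
     exists Q : {set 'I_N}, #|Q| = q /\ good x y Q) ->
  (forall x y y' (Q : {set 'I_N}), good x y Q -> {in Q, cell y =1 cell y'} -> good x y' Q) ->
  (forall x (y : {set E}) Q, good x y Q -> [disjoint Es x & y]) ->
  #|X| * 2 ^ (#|E| - l) <=
    'C(N, q) * (2 ^ #|E| * b + #|W| ^ q * 2 ^ (#|E| - E0) * #|X|).
Proof.
move=> cE spread complete localQ sound.
have -> : #|X| * 2 ^ (#|E| - l) = \sum_x \sum_(y : {set E}) [disjoint Es x & y].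
  rewrite -sum_nat_const; apply: eq_bigr => x _.
  by rewrite -(cE x) -card_disjoint_sets -sum1dep_card big_mkcond.
have le_QG : \sum_x \sum_(y : {set E}) [disjoint Es x & y] <=
    \sum_(Q : {set 'I_N} | #|Q| == q) \sum_(y : {set E}) #|[set x | good x y Q]|.
  under [leqRHS]eq_bigr => Q _ do
    (under eq_bigr => y _ do rewrite -sum1dep_card big_mkcond; rewrite exchange_big).
  rewrite [leqRHS]exchange_big; apply: leq_sum => x _.
  rewrite [leqRHS]exchange_big; apply: leq_sum => y _.
  case D: [disjoint _ & _] => //; have [Q [cQ gQ]] := complete _ _ D.
  by rewrite (bigD1 Q) ?cQ //= gQ.
apply: (leq_trans le_QG); rewrite -[N in 'C(N, q)]card_ord -(card_draws 'I_N q).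
rewrite -sum1dep_card big_distrl /=; apply: leq_sum => Q /eqP cQ; rewrite mul1n.
pose F y := \bigcup_(x | good x y Q) Es x.
pose bad := [set y | E0 < #|F y|].
have sub_F y : [set x | good x y Q] \subset [set x | Es x \subset F y].
  by apply/subsetP => x; rewrite !inE => gx; apply: bigcup_sup.
have card_bad : #|bad| <= #|W| ^ q * 2 ^ (#|E| - E0).
  (* Bad sets with the same contents of [Q] as [y] all avoid [F y], which has more than [E0]
     edges. *)
  pose f y := [ffun i : {i | i \in Q} => cell y (val i)].
  have -> : #|W| ^ q = #|{ffun {i | i \in Q} -> W}|.
    by rewrite card_ffun card_sig -cQ; congr (_ ^ _); apply: eq_card.
  apply: (leq_card_fibres (f := f)) => y; rewrite inE => bad_y.
  apply: (@leq_trans (2 ^ (#|E| - #|F y|))); last first.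
    by rewrite leq_exp2l // leq_sub2l // ltnW.
  rewrite -card_disjoint_sets; apply: subset_leq_card; apply/subsetP => y'.
  rewrite !inE => /andP[_ /eqP eq_f]; rewrite disjoint_sym.
  apply/bigcup_disjointP => x gx; rewrite disjoint_sym.
  apply: (sound _ _ Q); apply: (localQ _ y) => // i iQ.
  by move/ffunP/(_ (exist _ i iQ)): eq_f; rewrite !ffunE.
rewrite (bigID (mem bad) xpredT) /= addnC; apply: leq_add.
- apply: (@leq_trans (\sum_(y | y \notin bad) b)).
    apply: leq_sum => y; rewrite inE -leqNgt => le_F.
    exact: leq_trans (subset_leq_card (sub_F y)) (spread _ le_F).
  rewrite sum_nat_const leq_mul2r; apply/orP; right.
  apply: (leq_trans (max_card _)).
  by rewrite -cardsT -powersetT card_powerset cardsT.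
- apply: (@leq_trans (\sum_(y in bad) #|X|)).
    by apply: leq_sum => y _; apply: max_card.
  by rewrite sum_nat_const leq_mul2r card_bad orbT.
Qed.

(** * Butterflies *)

Section Butterfly.
Variables (d A B : nat) (b0 : 'I_B).

Notation word := {ffun 'I_d -> 'I_B}.
Notation node := ('I_d * 'I_A * word)%type.
Notation edge := (node * 'I_B)%type.
Notation strategy := {ffun node -> 'S_B}.

Definition setc (z : word) (i : 'I_d) (b : 'I_B) : word :=
  [ffun j => if j == i then b else z j].

Lemma setcK z i b c : setc (setc z i b) i c = setc z i c.
Proof. by apply/ffunP => j; rewrite !ffunE; case: eqP. Qed.

Lemma setc_id z i : setc z i (z i) = z.
Proof. by apply/ffunP => j; rewrite !ffunE; case: eqP => // ->. Qed.

Definition coord (n : node) : 'I_B := n.2 n.1.1.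
Definition put (n : node) (b : 'I_B) : node := (n.1, setc n.2 n.1.1 b).

Lemma putK n b c : put (put n b) c = put n c.
Proof. by rewrite /put setcK. Qed.

Lemma put_id n : put n (coord n) = n.
Proof. by case: n => ia z; rewrite /put setc_id. Qed.

Lemma coord_put n b : coord (put n b) = b.
Proof. by rewrite /coord ffunE eqxx. Qed.

(* One permutation per level, copy and class of words which agree off the current
   coordinate; the class is represented by its word with that coordinate reset to
   [b0], and the values of [x] at other nodes are ignored. *)
Definition chosen (x : strategy) (n : node) : 'I_B := x (put n b0) (coord n).
Definition used_edges (x : strategy) : {set edge} := [set (n, chosen x n) | n : node].

Lemma card_used_edges x : #|used_edges x| = #|{: node}|.
Proof. by rewrite card_imset // => n n' []. Qed.

Lemma prod_nodes (g : node -> nat) :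
  \prod_n g n = \prod_(n | coord n == b0) \prod_b g (put n b).
Proof.
rewrite (partition_big (put^~ b0) (fun n => coord n == b0)) /=; last first.
  by move=> n _; rewrite coord_put.
apply: eq_bigr => n /eqP cn.
rewrite (reindex_onto (put n) coord) /=; last first.
  by move=> n' /eqP <-; rewrite putK put_id.
by apply: eq_bigl => b; rewrite putK coord_put -cn put_id !eqxx.
Qed.

Lemma card_family_prod (I J : finType) (F : I -> {set J}) :
  #|family (fun i => mem (F i))| = \prod_i #|F i|.
Proof. by rewrite card_family foldrE big_map -big_enum. Qed.

(** Makes a product of row sizes depend only on their sum, through an exponent; uses
    [m < R * (m %/ R + 1)]. *)
Lemma le_mul_exp_div m R : 0 < R -> m <= R * 2 ^ (m %/ R).
Proof.
move=> R_gt0; rewrite {1}(divn_eq m R).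
have := ltn_expl (m %/ R) (ltnSn 1); have := ltn_pmod m R_gt0; nia.
Qed.

(** As [B = R ^ 2], the factors [R ^ B] from the rows and from the left side multiply to [B ^ B], at
    most [4 ^ B] times the factorial of [B]. *)
Lemma card_perms_in (n : node) (F : {set edge}) R : 0 < R -> B = R ^ 2 ->
  #|[set s : 'S_B | [forall b, (put n b, s b) \in F]]| * \prod_(b < B) R <=
    B`! * \prod_(b < B) (4 * 2 ^ (#|[set c | (put n b, c) \in F]| %/ R)).
Proof.
move=> R_gt0 BR; pose row b := #|[set c | (put n b, c) \in F]|.
have le_rows : #|[set s : 'S_B | [forall b, (put n b, s b) \in F]]| <=
    \prod_b row b.
  have inj : injective (fun s : 'S_B => [ffun b => s b]).
    by move=> s s' /ffunP eqs; apply/permP => b; have := eqs b; rewrite !ffunE.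
  rewrite -(card_imset _ inj).
  rewrite -(card_family_prod (fun b => [set c | (put n b, c) \in F])).
  apply/subset_leq_card/subsetP => f /imsetP[s sF ->].
  apply/familyP => b; rewrite inE ffunE in sF *.
  by rewrite inE; move/forallP: sF.
apply: (leq_trans (leq_mul le_rows (leqnn _))).
have le_R : \prod_b row b <= \prod_(b < B) (R * 2 ^ (row b %/ R)).
  by apply: leq_prod => b _; apply: le_mul_exp_div.
apply: (leq_trans (leq_mul le_R (leqnn _))).
rewrite !big_split /= mulnAC !prod_nat_const card_ord mulnA leq_mul2r.
apply/orP; right; rewrite -expnMn mulnn -BR mulnC; exact: expnn_le_fact.
Qed.

(* The permutations inside a given edge set number at most the product of the row
   sizes, and a row of size [m] counts for at most [R * 2 ^ (m %/ R)]. *)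
Lemma strategies_spread (F : {set edge}) R : 0 < R -> B = R ^ 2 ->
  #|F| <= R * #|{: node}| ->
  #|[set x | used_edges x \subset F]| * R ^ #|{: node}| <=
    8 ^ #|{: node}| * #|{: strategy}|.
Proof.
move=> R_gt0 BR le_F; pose row n := #|[set c | (n, c) \in F]|.
pose G n := if coord n == b0
  then [set s : 'S_B | [forall b, (put n b, s b) \in F]] else [set: 'S_B].
have le_fam : #|[set x | used_edges x \subset F]| <= \prod_n #|G n|.
  rewrite -card_family_prod; apply/subset_leq_card/subsetP => x.
  rewrite inE => /subsetP sub; apply/familyP => n; rewrite /G.
  case: eqP => [cn|]; rewrite inE //; apply/forallP => b; apply: sub.
  apply/imsetP; exists (put n b) => //.
  by rewrite /chosen putK coord_put -cn put_id.
have -> : #|{: strategy}| = \prod_(n : node) B`!.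
  by rewrite card_ffun card_Sn prod_nat_const.
have row_sum : \sum_n row n = #|F|.
  rewrite -[RHS]sum1_card [RHS](partition_big fst xpredT) //=.
  apply: eq_bigr => n _; rewrite sum1dep_card /row.
  have inj : injective (fun c : 'I_B => (n, c)) by move=> c c' [].
  rewrite -(card_imset _ inj); apply: eq_card => -[n' c']; rewrite !inE /=.
  apply/imsetP/andP => [[c]|[nF /eqP En]].
    by rewrite inE => nF [-> ->].
  by exists c'; rewrite ?inE -?En.
have rows_le : \prod_n 2 ^ (row n %/ R) <= 2 ^ #|{: node}|.
  rewrite -expn_sum leq_exp2l //; apply: (@leq_trans (#|F| %/ R)).
    rewrite leq_divRL // -row_sum big_distrl /=.
    by apply: leq_sum => n _; apply: leq_trunc_div.
  by apply: (leq_trans (leq_div2r R le_F)); rewrite mulKn.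
have core : \prod_n #|G n| * \prod_(n : node) R <=
    \prod_(n : node) B`! * \prod_n (4 * 2 ^ (row n %/ R)).
  rewrite (prod_nodes (fun=> R)) (prod_nodes (fun n => 4 * 2 ^ (row n %/ R))).
  rewrite !(bigID (fun n => coord n == b0) xpredT) /=.
  rewrite [leqLHS]mulnAC [leqRHS]mulnAC; apply: leq_mul.
    rewrite -!big_split /=; apply: leq_prod => n cn.
    by rewrite /G cn; apply: card_perms_in.
  by apply: leq_prod => n; rewrite /G => /negPf->; rewrite -card_Sn max_card.
rewrite -[R ^ _]prod_nat_const.
apply: (leq_trans (leq_mul le_fam (leqnn _))); apply: (leq_trans core).
rewrite mulnC leq_mul2r big_split /= prod_nat_const; apply/orP; right.
by rewrite -[8]/(4 * 2) expnMn; apply: leq_mul; rewrite // prod_nat_const.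
Qed.

(** * Paths routed by a strategy *)

Definition step (x : strategy) (a : 'I_A) (z : word) (i : 'I_d) : word :=
  setc z i (chosen x (i, a, z)).

(** Equal images agree off coordinate [i], so both words lie in one class, where a single
    permutation chose the new digit. *)
Lemma step_inj x a i : injective (step x a ^~ i).
Proof.
move=> z z' eq_s.
have eq_r : setc z i b0 = setc z' i b0.
  by move: (congr1 (fun z => setc z i b0) eq_s); rewrite !setcK.
have := congr1 (fun z : word => z i) eq_s.
rewrite !ffunE !eqxx /chosen /put /= eq_r => /perm_inj; rewrite /coord /= => eq_i.
have := congr1 (fun y => setc y i (z i)) eq_r.
by rewrite !setcK setc_id eq_i setc_id.
Qed.

Fixpoint path_word (x : strategy) (a : 'I_A) (u : word) (k : nat) : word :=
  if k is k'.+1 then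
    let z := path_word x a u k' in
    if insub k' is Some i then step x a z i else z
  else u.

Definition dest x a u := path_word x a u d.

Lemma path_wordS x a u (i : 'I_d) :
  path_word x a u i.+1 = step x a (path_word x a u i) i.
Proof. by rewrite /= valK. Qed.

Lemma path_word_bij x a k : bijective (path_word x a ^~ k).
Proof.
apply: injF_bij; elim: k => [|k IH] u v //=.
by case: insubP => [i _ _ /step_inj|_] /IH.
Qed.

Definition mix (u v : word) (i : 'I_d) : word := [ffun j : 'I_d => if j < i then v j else u j].

Lemma path_word_coord x a u k (j : 'I_d) : 
  path_word x a u k j = if j < k then path_word x a u j.+1 j else u j.
Proof.
elim: k => [|k IH] //; rewrite ltnS leq_eqVlt.
have [<- //|ne_jk /=] := eqVneq.
case: insubP => [i _ ik|_]; last exact: IH.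
by rewrite ffunE -val_eqE ik (negPf ne_jk).
Qed.

Lemma mix_path x a u (i : 'I_d) : mix u (dest x a u) i = path_word x a u i.
Proof.
apply/ffunP => j; rewrite ffunE [RHS]path_word_coord /dest.
by case: ifP => // _; rewrite path_word_coord ltn_ord.
Qed.

Definition path_edge a (u v : word) (i : 'I_d) : edge := ((i, a, mix u v i), v i).
Definition hits a u v (y : {set edge}) := [exists i, path_edge a u v i \in y].

(** At every level the paths of one copy pass bijectively through its nodes, so each used edge lies
    on the path of exactly one source. *)
Lemma disjoint_used_edges x (y : {set edge}) :
  [disjoint used_edges x & y] = [forall a, forall u, ~~ hits a u (dest x a u) y].
Proof.
have pathE a u i : path_edge a u (dest x a u) i =
    ((i, a, path_word x a u i), chosen x (i, a, path_word x a u i)).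
  rewrite /path_edge mix_path; congr (_, _).
  by rewrite /dest path_word_coord ltn_ord path_wordS ffunE eqxx.
apply/idP/forallP => [dis a|no].
  apply/forallP => u; apply/existsPn => i; rewrite pathE.
  by rewrite (disjointFr dis) //; apply: imset_f.
rewrite disjoints_subset; apply/subsetP => e /imsetP[[[i a] z] _ ->].
rewrite inE; have [w zK wK] := path_word_bij x a i.
by have /forallP/(_ (w z))/existsPn/(_ i) := no a; rewrite pathE wK.
Qed.
End Butterfly.

Lemma common_atP S T i j l : reflect
  [/\ i + l <= size S, j + l <= size T &
      forall k, k < l -> nth 0 S (i + k) = nth 0 T (j + k)]
  (common_at S T i j l).
Proof.
apply: (iffP and3P) => -[szS szT eqST]; split=> //.
  by move=> k lt_kl; move/eqP/(congr1 (nth 0 ^~ k)): eqST; rewrite !nth_take // !nth_drop.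
apply/eqP/(@eq_from_nth _ 0); first by rewrite !size_takel ?size_drop //; lia.
move=> k; rewrite size_takel ?size_drop; last lia.
by move=> lt_kl; rewrite !nth_take // !nth_drop eqST.
Qed.

(** * Encoding into strings *)

Section Strings.
Variables (d A B : nat).

Notation word := {ffun 'I_d -> 'I_B}.
Notation edge := ('I_d * 'I_A * word * 'I_B)%type.
Variable e0 : edge.

(* Alphabet: digits are [0 .. B - 1]; [hash a] occurs only in [T] and at the
   substituted position of [S], [blank] only in [S], and [sep] only in [T]. *)
Definition digit (z : word) (h : nat) : nat := if insub h is Some i then val (z i) else 0.
Definition hash (a : 'I_A) := B + a.
Definition blank := B + A.
Definition sep := (B + A).+1.

Definition block_letter (u v : word) h :=
  if h < d then digit u h
  else if (d < h) && (h <= 2 * d) then digit v (h - d.+1) else blank.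

(* Offsets count from the start of a block of [S], whose centre is at offset [d];
   an edge leaving level [i] is matched at the offsets from [i] to [i + d + 1]. *)
Definition atom_letter (e : edge) h :=
  let: (i, a, z, b) := e in
  if h < d then digit z h else if h == d then hash a
  else if h - d.+1 < i then digit z (h - d.+1) else val b.

Definition block_at r := nth (e0.1.2, e0.1.2) (enum {: word * word}) r.
Definition edge_at g := nth e0 (enum {: edge}) g.

Definition query_text : seq nat :=
  mkseq (fun p => let uv := block_at (p %/ (2 * d).+2) in
                  block_letter uv.1 uv.2 (p %% (2 * d).+2))
        (#|{: word * word}| * (2 * d).+2).

(** An absent edge keeps its slot, filled with [sep], so that positions and length do not depend on
    [y]. *)
Definition edge_text (y : {set edge}) : seq nat :=
  mkseq (fun j => let e := edge_at (j %/ d.+3) in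
                  if (e \in y) && (j %% d.+3 < d.+2)
                  then atom_letter e (e.1.1.1 + j %% d.+3) else sep)
        (#|{: edge}| * d.+3).

Definition centre (u v : word) := index (u, v) (enum {: word * word}) * (2 * d).+2 + d.

Lemma digit_ord z (i : 'I_d) : digit z i = z i.
Proof. by rewrite /digit valK. Qed.

Lemma digit_lt z h : digit z h < B.
Proof. rewrite /digit; case: insubP => [i _ _|_]; first exact: ltn_ord.
by have := ltn_ord e0.2; lia. Qed.

Lemma mul_add_lt r N D h : r < N -> h < D -> r * D + h < N * D.
Proof. nia. Qed.

Lemma nth_mul_add (f : nat -> nat) N D r h : r < N -> h < D ->
  nth 0 (mkseq f (N * D)) (r * D + h) = f (r * D + h).
Proof. by move=> ltr lth; rewrite nth_mkseq // mul_add_lt. Qed.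

Lemma query_text_nth r h : r < #|{: word * word}| -> h < (2 * d).+2 ->
  nth 0 query_text (r * (2 * d).+2 + h) = block_letter (block_at r).1 (block_at r).2 h.
Proof.
by move=> ltr lth; rewrite nth_mul_add // divnMDl // divn_small // modnMDl modn_small // addn0.
Qed.

Lemma edge_text_nth y g h : g < #|{: edge}| -> h < d.+3 ->
  nth 0 (edge_text y) (g * d.+3 + h) =
    if (edge_at g \in y) && (h < d.+2)
    then atom_letter (edge_at g) ((edge_at g).1.1.1 + h) else sep.
Proof.
by move=> ltr lth; rewrite nth_mul_add // divnMDl // divn_small // modnMDl modn_small // addn0.
Qed.

Lemma block_letter_range u v h : block_letter u v h < B \/ block_letter u v h = blank.
Proof.
rewrite /block_letter; case: ifP => _; first by left; apply: digit_lt.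
by case: ifP => _; [left; apply: digit_lt | right].
Qed.

Lemma query_text_range p : nth 0 query_text p < B \/ nth 0 query_text p = blank.
Proof.
have [lt_p|le_p] := ltnP p (size query_text); last first.
  by left; rewrite nth_default //; have := ltn_ord e0.2; lia.
rewrite size_mkseq in lt_p; rewrite nth_mkseq //=; exact: block_letter_range.
Qed.

Lemma atom_letter_range e h : atom_letter e h < B + A.
Proof.
case: e => [[[i a] z] b] /=; have := ltn_ord a; have := ltn_ord b.
have Hd h' := digit_lt z h'; rewrite /hash.
by do 3?case: ifP => _; try lia; have := Hd h; have := Hd (h - d.+1); lia.
Qed.

Lemma query_text_letters : all (fun c => c < (B + A).+2) query_text.
Proof.
apply/(all_nthP 0) => p _; have := query_text_range p; rewrite /blank; lia.
Qed.

Lemma edge_text_letters y : all (fun c => c < (B + A).+2) (edge_text y).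
Proof.
apply/(all_nthP 0) => p; rewrite size_mkseq => lt_p; rewrite nth_mkseq //=.
case: ifP => _; last by rewrite /sep.
by have := atom_letter_range; move=> H; apply: ltn_trans (H _ _) _.
Qed.

Lemma block_at_index u v : block_at (index (u, v) (enum {: word * word})) = (u, v).
Proof. by rewrite /block_at nth_index ?mem_enum. Qed.

Lemma index_block_lt u v : index (u, v) (enum {: word * word}) < #|{: word * word}|.
Proof. by rewrite cardE index_mem mem_enum. Qed.

Lemma centre_lt u v : centre u v < size query_text.
Proof. by rewrite size_mkseq; apply: mul_add_lt (index_block_lt u v) _; lia. Qed.

Section Query.
Variables (a : 'I_A) (u v : word) (y : {set edge}).
Let S' := set_nth 0 query_text (centre u v) (hash a).

Lemma size_query : size S' = #|{: word * word}| * (2 * d).+2.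
Proof.
rewrite size_set_nth -[RHS](size_mkseq _ _ : size query_text = _).
exact/maxn_idPr/centre_lt.
Qed.

Lemma query_nth h : h < (2 * d).+2 ->
  nth 0 S' (index (u, v) (enum {: word * word}) * (2 * d).+2 + h) =
    if h == d then hash a else block_letter u v h.
Proof.
move=> lt_h; rewrite nth_set_nth /= /centre eqn_add2l; case: eqP => // _.
by rewrite query_text_nth ?index_block_lt // block_at_index.
Qed.

Lemma query_hash p (a' : 'I_A) : nth 0 S' p = hash a' -> p = centre u v /\ a' = a.
Proof.
rewrite nth_set_nth /=; case: eqP => [-> /addnI/val_inj->//|_].
by have := query_text_range p; have := ltn_ord a'; rewrite /hash /blank; lia.
Qed.

Lemma query_neq_sep p : nth 0 S' p <> sep.
Proof.
rewrite nth_set_nth /=; case: eqP => _; first by have := ltn_ord a; rewrite /hash /sep; lia.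
by have := query_text_range p; rewrite /sep /blank; lia.
Qed.

(** The path edge at level [i] spells [u_i .. u_(d-1) #_a v_0 .. v_i], the window of the block
    starting at offset [i]. *)
Lemma hits_common : hits a u v y ->
  exists i j, common_at S' (edge_text y) i j d.+2.
Proof.
case/existsP => i ey; pose e := path_edge a u v i.
have eK : edge_at (index e (enum {: edge})) = e by rewrite /edge_at nth_index ?mem_enum.
have lt_g : index e (enum {: edge}) < #|{: edge}| by rewrite cardE index_mem mem_enum.
exists (index (u, v) (enum {: word * word}) * (2 * d).+2 + i).
exists (index e (enum {: edge}) * d.+3).
have lt_i := ltn_ord i; have lt_uv := index_block_lt u v.
apply/common_atP; split; first by rewrite size_query -addnA ltnW // mul_add_lt //; lia.
  by rewrite size_mkseq ltnW // mul_add_lt.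
move=> k lt_k; rewrite -addnA query_nth; last lia.
rewrite edge_text_nth //; last lia.
rewrite eK ey lt_k /= /block_letter.
have [-> |ne_d] := eqVneq (i + k) d; first by rewrite ltnn.
case: ltnP => [lt_d|le_d].
  by rewrite /digit insubT /= ffunE ltnNge leq_addr.
have -> : (d < i + k) && (i + k <= 2 * d) by lia.
case: ltnP => [lt_i'|le_i'].
  have lt_d : i + k - d.+1 < d by lia.
  by rewrite /digit insubT /= ffunE lt_i'.
have -> : i + k - d.+1 = i by lia.
exact: digit_ord.
Qed.

(** Avoiding [sep] forces the match onto the slot of an edge of [y]; its hash then aligns with
    [centre u v], and the other letters identify the edge. *)
Lemma common_hits i' j' : common_at S' (edge_text y) i' j' d.+2 -> hits a u v y.
Proof.
case/common_atP => _ szT eqST; rewrite size_mkseq in szT.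
pose g := j' %/ d.+3; pose h := j' %% d.+3.
have Ej : j' = g * d.+3 + h by apply: divn_eq.
have lt_h : h < d.+3 by apply: ltn_pmod.
have lt_g : g < #|{: edge}| by nia.
(* A window of [d + 2] letters starting later in the slot meets the [sep] at offset [d + 2]. *)
have h0 : h = 0.
  apply/eqP; rewrite -leqn0 leqNgt; apply/negP => h_gt0.
  have /eqST : d.+2 - h < d.+2 by lia.
  have -> : j' + (d.+2 - h) = g * d.+3 + d.+2 by lia.
  by rewrite edge_text_nth // ltnn andbF => /query_neq_sep.
rewrite h0 addn0 in Ej.
have [e def_e] : exists e, edge_at g = e by eexists.
have ey : e \in y.
  apply/negPn/negP => /negPf ey; have := eqST 0 isT; rewrite Ej edge_text_nth //.
  by rewrite def_e ey => /query_neq_sep.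
have {}eqST k : k < d.+2 -> nth 0 S' (i' + k) = atom_letter e (e.1.1.1 + k).
  by move=> lt_k; rewrite eqST // Ej edge_text_nth ?def_e ?ey ?lt_k //; lia.
case: e => [[[i b] z] c] /= in def_e ey eqST.
have lt_i := ltn_ord i.
have [|Ei Eb] := @query_hash (i' + (d - i)) b.
  rewrite eqST; last lia.
  have -> : i + (d - i) = d by lia.
  by rewrite ltnn eqxx.
have {}eqST k : k < d.+2 -> i + k != d -> block_letter u v (i + k) =
    if i + k < d then digit z (i + k)
    else if i + k - d.+1 < i then digit z (i + k - d.+1) else c.
  move=> lt_k ne_d; have := eqST _ lt_k.
  have -> : i' + k = index (u, v) (enum {: word * word}) * (2 * d).+2 + (i + k).
    by move: Ei; rewrite /centre; lia.
  by rewrite query_nth ?(negPf ne_d) //; lia.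
apply/existsP; exists i; suff -> : path_edge a u v i = (i, b, z, c) by [].
(* The last letter gives the digit; letters before the hash give the coordinates from [i] on, those
   after it the earlier ones. *)
rewrite /path_edge Eb; congr (_, _, _); last first.
  apply: val_inj; have := eqST d.+1 (ltnSn _); rewrite /block_letter.
  have -> : (i + d.+1 < d) = false by lia.
  have -> : (d < i + d.+1) && (i + d.+1 <= 2 * d) by lia.
  by rewrite addnK ltnn digit_ord => H; apply: H; lia.
apply/ffunP => j; rewrite ffunE; have lt_j := ltn_ord j; apply: val_inj.
case: ifP => lt_ji.
  have /eqST : d.+1 + j - i < d.+2 by lia.
  have -> : i + (d.+1 + j - i) = j + d.+1 by lia.
  rewrite /block_letter addnK lt_ji !digit_ord.
  have -> : (j + d.+1 < d) = false by lia.
  have -> : (d < j + d.+1) && (j + d.+1 <= 2 * d) by lia.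
  by move=> H; apply: H; lia.
have /eqST : j - i < d.+2 by lia.
rewrite subnKC; last lia.
by rewrite /block_letter lt_j !digit_ord => H; apply: H; lia.
Qed.

Lemma lcs_hits o : is_lcs S' (edge_text y) o -> (d.+2 <= o.2) = hits a u v y.
Proof.
case: o => [[i j] l] [/common_atP[szS szT eqST] maxl].
apply/idP/idP => /= [le_l|/hits_common[i' [j' /maxl]] //].
apply: (@common_hits i j); apply/common_atP; split; try lia.
by move=> k lt_k; apply: eqST; lia.
Qed.
End Query.
End Strings.

(** * The lower bound *)

Section CellProbe.
Variables (d A B : nat).
Notation word := {ffun 'I_d -> 'I_B}.
Notation node := ('I_d * 'I_A * word)%type.
Notation edge := (node * 'I_B)%type.
Notation strategy := {ffun node -> 'S_B}.
Variables (e0 : edge) (D : lcs_ds) (n w s t : nat).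
Hypotheses (correctD : correct_ds D n w s t)
  (text_le : #|{: word * word}| * (2 * d).+2 <= n)
  (edges_le : #|{: edge}| * d.+3 <= n)
  (letters_le : (B + A).+2 <= 2 ^ w).

Let memory (y : {set edge}) := ds_init D (query_text e0) (edge_text e0 y).
Let query (a : 'I_A) (u v : word) := ds_update D (centre u v) (hash B a).

Lemma memory_correct y : (forall c, memory y c < 2 ^ w) /\
  forall ops, serves D w s t (edge_text e0 y) (query_text e0) (memory y) ops.
Proof.
have letters S : all (fun c => c < (B + A).+2) S -> all (fun c => c < 2 ^ w) S.
  by apply: sub_all => c lt_c; apply: leq_trans letters_le.
apply: correctD; rewrite ?size_mkseq //; apply: letters.
  exact: query_text_letters.
exact: edge_text_letters.
Qed.

Lemma query_output y a u v : exists o, [/\ output w s (query a u v) (memory y) = Some o,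
  size (probes w (query a u v) (memory y)) <= t,
  {in probes w (query a u v) (memory y), forall c, c < s} &
  (d.+2 <= o.2) = hits a u v y].
Proof.
have [_ serv] := memory_correct y.
have := serv [:: (centre u v, hash B a)]; rewrite /= => /(_ (centre_lt e0 u v)).
have lt_a : hash B a < 2 ^ w by have := ltn_ord a; rewrite /hash; lia.
move/(_ lt_a); rewrite -/(query a u v) -/(memory y).
case Ex: exec => [[[o m'] c]|] // [le_c [/lcs_hits lcs_o _]].
have [sz lts] := probes_bound Ex.
by exists o; split; rewrite ?/output ?Ex //; apply: leq_trans le_c.
Qed.

Lemma memory_lt y c : memory y c < 2 ^ w.
Proof. by have [] := memory_correct y. Qed.

Let k := #|{: 'I_A * word}|.
(** [t.+1] keeps [q] positive for [t = 0], as the binomial estimate requires. *)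
Let q := k * t.+1.

Lemma cell_probe_counting R : 0 < R -> B = R ^ 2 ->
  #|{: strategy}| * 2 ^ (#|{: edge}| - #|{: node}|) <=
    'C(s + q, q) * (2 ^ #|{: edge}| * (8 ^ #|{: node}| * #|{: strategy}| %/ R ^ #|{: node}|)
       + (2 ^ w) ^ q * 2 ^ (#|{: edge}| - R * #|{: node}|) * #|{: strategy}|).
Proof.
move=> R_gt0 BR; pose b0 : 'I_B := e0.2.
(* The [q] extra addresses ensure that a set of [q] cells exists even for small [s]. *)
pose cell y (i : 'I_(s + q)) := Ordinal (memory_lt y i).
pose prog_of (x : strategy) (au : 'I_A * word) := query au.1 au.2 (dest b0 x au.1 au.2).
pose good x y (Q : {set 'I_(s + q)}) := [forall au,
  (if output w s (prog_of x au) (memory y) is Some o then o.2 < d.+2 else false) &&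
  all (fun c => [exists i in Q, val i == c]) (probes w (prog_of x au) (memory y))].
rewrite -[2 ^ w]card_ord.
apply: (@richness _ _ _ _ _ _ _ _ (used_edges b0) cell good).
- by move=> x; apply: card_used_edges.
- move=> F le_F; rewrite leq_divRL ?expn_gt0 ?R_gt0 //.
  exact: strategies_spread.
- move=> x y; rewrite disjoint_used_edges => /forallP dis.
  pose P := \bigcup_au [set i : 'I_(s + q) | val i \in probes w (prog_of x au) (memory y)].
  have cP : #|P| <= q.
    apply: (@leq_trans (\sum_(au : 'I_A * word) t)); last first.
      by rewrite sum_nat_const leq_mul2l leqnSn orbT.
    apply: (@leq_trans (\sum_au size (probes w (prog_of x au) (memory y)))); last first.
      by apply: leq_sum => au _; have [o []] := query_output y au.1 au.2 (dest b0 x au.1 au.2).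
    rewrite /P; elim/big_rec2: _ => [|au m U _ le_U]; first by rewrite cards0.
    apply: (leq_trans (leq_card_setU _ _)); apply: leq_add => //.
    rewrite cardE -(size_map val); apply: uniq_leq_size.
      by rewrite map_inj_uniq ?enum_uniq //; apply: val_inj.
    by move=> c /mapP[i]; rewrite mem_enum inE => ? ->.
  have [|Q [sPQ cQ]] := superset_card cP; first by rewrite card_ord leq_addl.
  exists Q; split=> //; apply/forallP => au.
  have [o [outo _ lts hit]] := query_output y au.1 au.2 (dest b0 x au.1 au.2).
  rewrite /prog_of outo ltnNge hit; have /forallP -> /= := dis au.1.
  apply/allP => c pc; have lt_c : c < s + q by apply: ltn_addr; apply: lts.
  apply/existsP; exists (Ordinal lt_c); rewrite eqxx andbT.
  by apply: (subsetP sPQ); apply/bigcupP; exists au; rewrite ?inE.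
- move=> x y y' Q /forallP gd eqQ; apply/forallP => au.
  have /andP[gdo /allP gdp] := gd au.
  have [|-> -> ] := @output_local _ w s (prog_of x au) (memory y) (memory y').
    move=> c /gdp /existsP[i /andP[iQ /eqP <-]].
    by have /(congr1 val) := eqQ _ iQ.
  by rewrite gdo; apply/allP.
- move=> x y Q /forallP gd; rewrite disjoint_used_edges.
  apply/forallP => a; apply/forallP => u; have /andP[+ _] := gd (a, u).
  have [o [outo _ _ <-]] := query_output y a u (dest b0 x a u).
  by rewrite /prog_of /= outo -ltnNge.
Qed.

(** Each bound makes one summand of the counting estimate at most a quarter of its left side. In
    [bound1], [4 * d] pays for factors [8] and [2] per node, and [2] for the quarter. *)
Lemma cell_probe_contradiction rho lam : B = 2 ^ (2 * rho) -> 0 < A -> 0 < B ->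
  s + q <= q * 2 ^ lam ->
  (lam + 2) * t.+1 + 4 * d + 2 <= rho * d ->
  (lam + 2) * t.+1 + w * t.+1 + d + 2 <= 2 ^ rho * d -> False.
Proof.
move=> EB A_gt0 B_gt0 le_s bound1 bound2.
have k_gt0 : 0 < k.
  by rewrite /k card_prod card_ord card_ffun !card_ord muln_gt0 A_gt0 expn_gt0 B_gt0.
have BR : B = (2 ^ rho) ^ 2 by rewrite EB mulnC expnM.
have R_gt0 : 0 < 2 ^ rho by rewrite expn_gt0.
have := cell_probe_counting R_gt0 BR.
have -> : #|{: edge}| = #|{: node}| * B by rewrite card_prod card_ord.
have l_dk : #|{: node}| = d * k by rewrite /k !card_prod !card_ord mulnA.
have q_gt0 : 0 < q by rewrite /q muln_gt0 k_gt0.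
have leC := binomial_le_expn le_s q_gt0; rewrite /q in leC *.
set l := #|{: node}| in l_dk *; set X := #|{: strategy}|; set C := 'C(_, _) in leC *.
have X_gt0 : 0 < X by rewrite /X card_ffun card_Sn expn_gt0 fact_gt0.
have le_RB : 2 ^ rho * l <= l * B.
  by rewrite mulnC leq_mul2l BR expnS expn1 leq_pmulr ?orbT.
have le_lB : l <= l * B by rewrite leq_pmulr.
set U := l * B in le_RB le_lB *; set Q := k * t.+1 in leC *.
have b1 : (lam + 2) * Q + 4 * l + 2 <= rho * l.
  rewrite l_dk /Q; have := leq_mul (leqnn k) bound1; nia.
have b2 : (lam + 2) * Q + w * Q + l + 2 <= 2 ^ rho * l.
  rewrite l_dk /Q; have := leq_mul (leqnn k) bound2; nia.
have term1 : 4 * (C * (2 ^ U * (8 ^ l * X %/ (2 ^ rho) ^ l))) <= X * 2 ^ (U - l).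
  rewrite -(@leq_pmul2r (2 ^ (rho * l))) ?expn_gt0 // -expnM.
  apply: (@leq_trans (4 * (2 ^ ((lam + 2) * Q) * (2 ^ U * (8 ^ l * X))))).
    rewrite -!mulnA leq_mul2l; apply/orP; right; apply: leq_mul => //.
    by rewrite leq_mul2l leq_trunc_div orbT.
  apply: (@leq_trans (2 ^ (2 + (lam + 2) * Q + U + 3 * l) * X)).
    have -> : 8 ^ l = 2 ^ (3 * l) by rewrite expnM.
    by rewrite !expnD; lia.
  rewrite [X * _]mulnC mulnAC -expnD leq_mul2r leq_exp2l //.
  by apply/orP; right; lia.
have term2 : 4 * (C * ((2 ^ w) ^ Q * 2 ^ (U - 2 ^ rho * l) * X)) <= X * 2 ^ (U - l).
  rewrite [X * _]mulnC !mulnA leq_mul2r; apply/orP; right.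
  apply: (@leq_trans (4 * 2 ^ ((lam + 2) * Q) * (2 ^ w) ^ Q * 2 ^ (U - 2 ^ rho * l))).
    by rewrite !leq_mul2r leq_mul2l leC !orbT.
  by rewrite -[4]/(2 ^ 2) -expnM -!expnD leq_exp2l //; lia.
have pos : 0 < X * 2 ^ (U - l) by rewrite muln_gt0 X_gt0 expn_gt0.
rewrite mulnDr; move: pos term1 term2; lia.
Qed.
End CellProbe.

(** * Choice of the parameters *)

Lemma sqr_le_exp2 m : 4 <= m -> m * m <= 2 ^ m.
Proof.
elim: m => // m IH; rewrite leq_eqVlt => /orP[/eqP <- //|le_4m].
by have := IH le_4m; rewrite expnS; nia.
Qed.

Lemma queries_le_maxn h t : 2 * h * t.+1 + 2 <= (4 * h + 2) * maxn t 1.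
Proof.
have := leq_mul (leqnn h) (leq_maxl t 1); have := leq_mul (leqnn h) (leq_maxr t 1).
have := leq_maxr t 1; lia.
Qed.

Lemma gap_le_sqr h C g : g = 2 * h + 2 * C + 12 -> h * (1 + g) + 2 * C + 3 <= g * g.
Proof. by move=> ->; nia. Qed.

Lemma word_bits_le h g C l w p : l < p -> w <= C * (2 * p) ->
  h * (l + g) + w + 3 <= p * (h * (1 + g) + 2 * C + 3).
Proof.
move=> lt_lp le_w; have := leq_mul (leqnn h) (ltnW lt_lp).
have : h * g <= h * g * p by rewrite leq_pmulr; lia.
lia.
Qed.

(* [rho] is [log log n + O(1)], and [d] is [Theta(log n / log log n)]. *)
Lemma parameters K c C : let h := K + c + 12 in
  exists k N : nat, 0 < k /\ forall n w t, N <= n ->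
    w <= C * trunc_log 2 n -> k * t * trunc_log 2 (trunc_log 2 n) < trunc_log 2 n ->
  0 < n /\ exists rho d,
    [/\ 12 <= rho, 2 * h * t.+1 + 2 <= d.+1,
        4 * rho * d.+1 <= trunc_log 2 n < 4 * rho * d.+2,
        4 * trunc_log 2 n <= 2 ^ rho & h * rho + w + 3 <= 2 ^ rho].
Proof.
move=> h; pose gam := 2 * h + 2 * C + 12.
(* [k] combines [rho <= (gam + 1) * ll] with [queries_le_maxn]; the threshold gives
   [k + 4 <= ll]. *)
pose k := 4 * (gam + 1) * (4 * h + 2); exists k, (2 ^ (2 ^ (k + 4))).
split=> [|n w t le_n le_wL]; first by rewrite /k; lia.
set L := trunc_log 2 n in le_wL *; set ll := trunc_log 2 L => lt_L.
have n_gt0 : 0 < n by apply: leq_trans le_n; rewrite expn_gt0.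
have le_kL : 2 ^ (k + 4) <= L by apply: trunc_log_max.
have L_gt0 : 0 < L by apply: leq_trans le_kL; rewrite expn_gt0.
have le_kll : k + 4 <= ll by apply: trunc_log_max.
have le_llL : 2 ^ ll <= L by apply: trunc_logP.
have lt_Lll : L < 2 ^ ll.+1 by apply: trunc_log_ltn.
clearbody ll L; clear le_n le_kL.
split=> //; pose rho := ll + gam.
have ll_gt0 : 0 < ll by apply: leq_trans le_kll; rewrite addnS.
have gam_ge : 12 <= gam by apply: leq_addl.
have rho_ge : 12 <= rho by apply: leq_trans gam_ge (leq_addl _ _).
have le_ktL : k * maxn t 1 * ll <= L.
  have [_|_] := leqP 1 t; first exact: ltnW.
  (* For [t = 0] the threshold yields [k * ll <= ll * ll <= 2 ^ ll <= L]. *)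
  rewrite muln1; apply: leq_trans le_llL; apply: leq_trans (sqr_le_exp2 _).
    by rewrite leq_mul2r (leq_trans (leq_addr 4 k) le_kll) orbT.
  exact: leq_trans (leq_addl k 4) le_kll.
have le_rho : rho <= (gam + 1) * ll.
  by rewrite /rho mulnDl mul1n addnC leq_add2r leq_pmulr.
have le_L : 4 * rho * (2 * h * t.+1 + 2) <= L.
  apply: leq_trans le_ktL; have := leq_mul le_rho (queries_le_maxn h t).
  rewrite /k; move: (2 * h * t.+1 + 2) (4 * h + 2) (gam + 1) (maxn t 1) (rho).
  by clear; lia.
(* Fitting [d + 1] instead of [d] leaves a factor [2 ^ (4 * rho)] for slot lengths and for the edges
   per source. *)
have [d Ed] : exists d, d.+1 = L %/ (4 * rho).
  exists (L %/ (4 * rho)).-1; rewrite prednK // divn_gt0; last by rewrite muln_gt0 (leq_trans _ rho_ge).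
  by apply: leq_trans le_L; rewrite leq_pmulr // addn2.
have rho4_gt0 : 0 < 4 * rho by rewrite muln_gt0 (leq_trans _ rho_ge).
exists rho, d; split=> //.
- by rewrite Ed leq_divRL // mulnC.
- by rewrite Ed mulnC leq_trunc_div /= mulnC ltn_ceil.
- apply: (leq_trans (leq_mul (leqnn 4) (ltnW lt_Lll))).
  rewrite -[4]/(2 ^ 2) -expnD leq_exp2l // addnC addSnnS leq_add2l.
  exact: leq_trans gam_ge.
- have le_w : w <= C * (2 * 2 ^ ll).
    by apply: (leq_trans le_wL); rewrite leq_mul2l -expnS ltnW ?orbT.
  have le_gam : h * (1 + gam) + 2 * C + 3 <= 2 ^ gam.
    apply: leq_trans (@gap_le_sqr h C gam erefl) _; apply: sqr_le_exp2.
    exact: leq_trans gam_ge.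
  rewrite /rho expnD; apply: leq_trans (leq_mul (leqnn _) le_gam).
  exact: word_bits_le (ltn_expl _ _) le_w.
Qed.

(* For every space bound s <= K n log^c n and word size log n <= w <= C log n,
   every correct structure has worst-case update time t = Omega(log n / log log n). *)
Theorem theorem27 :
  forall K c C : nat,
  exists k N : nat, 0 < k /\
  forall n, N <= n ->
  forall w s t (D : lcs_ds),
    trunc_log 2 n <= w -> w <= C * trunc_log 2 n ->
    s <= K * n * (trunc_log 2 n) ^ c ->
    correct_ds D n w s t ->
    trunc_log 2 n <= k * t * trunc_log 2 (trunc_log 2 n).
Proof.
move=> K c C; have [k [N [k_gt0 param]]] := parameters K c C; exists k, N.
split=> // n le_n w s t D le_Lw le_wL le_s correctD.
rewrite leqNgt; apply/negP => lt_L.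
have [n_gt0 [rho [d []]]] := param n w t le_n le_wL lt_L.
set L := trunc_log 2 n in le_Lw le_s *; set h := K + c + 12.
move=> rho_ge le_d /andP[le_dL lt_Ld] le_4L le_w {param lt_L le_wL le_n}.
have le_Ln : 2 ^ L <= n by apply: trunc_logP.
have lt_nL : n < 2 ^ L.+1 by apply: trunc_log_ltn.
clearbody L.
(* [K], [8 * rho] and [rho * c] cover the logarithms of [K], of [n] per source and of [L ^ c]; the
   rest leaves room for the summand [q]. *)
pose lam := K + 2 + 8 * rho + rho * c.
have rho_gt0 : 0 < rho by apply: ltn_trans rho_ge.
have d_gt0 : 0 < d by have := leq_trans (leq_addl _ 2) le_d.
have le_lam : lam + 2 <= h * rho.
  by rewrite /lam /h; have := leq_pmulr K rho_gt0; move: rho_ge; clear; lia.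
have le_d4 : 4 * d.+1 <= 2 ^ rho.
  by apply: leq_trans le_4L; rewrite leq_mul2l (leq_trans _ le_dL) ?leq_pmull ?muln_gt0.
(* With [B ^ d] copies there are as many sources as blocks, so the space per source is
   polylogarithmic. *)
pose B := 2 ^ (2 * rho); pose A := B ^ d.
have EA : A = 2 ^ (2 * rho * d) by rewrite [RHS]expnM.
have A_gt0 : 0 < A by rewrite EA expn_gt0.
have B_gt0 : 0 < B by rewrite expn_gt0.
have card_word : #|{: {ffun 'I_d -> 'I_B}}| = A by rewrite card_ffun !card_ord.
pose e0 : 'I_d * 'I_A * {ffun 'I_d -> 'I_B} * 'I_B :=
  (Ordinal d_gt0, Ordinal A_gt0, [ffun=> Ordinal B_gt0], Ordinal B_gt0).
have card_k : #|{: 'I_A * {ffun 'I_d -> 'I_B}}| = 2 ^ (4 * rho * d).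
  by rewrite card_prod card_word card_ord EA -expnD; congr (_ ^ _); clear; lia.
apply: (@cell_probe_contradiction d A B e0 D n w s t correctD _ _ _ rho lam) => //.
- apply: leq_trans le_Ln; rewrite card_prod card_word EA -expnD.
  have le_2d : (2 * d).+2 <= 2 ^ rho by move: le_d4; clear; lia.
  apply: (leq_trans (leq_mul (leqnn _) le_2d)).
  by rewrite -expnD leq_exp2l //; move: le_dL; clear; lia.
- apply: leq_trans le_Ln; rewrite !card_prod card_word !card_ord EA.
  have le_d1 : d <= 2 ^ rho by move: le_d4; clear; lia.
  have le_d3 : d.+3 <= 2 ^ rho by move: le_d4; clear; lia.
  apply: (@leq_trans (2 ^ rho * 2 ^ (2 * rho * d) * 2 ^ (2 * rho * d) * B * 2 ^ rho)).
    by rewrite !leq_mul.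
  by rewrite -!expnD leq_exp2l //; move: le_dL; clear; lia.
- apply: (@leq_trans (2 ^ L)); last by rewrite leq_exp2l.
  apply: (@leq_trans (2 ^ (2 * rho * d + 2))); last first.
    by rewrite leq_exp2l //; move: (leq0n (rho * d)) le_dL rho_gt0; clear; lia.
  have le_BA : B <= A by rewrite EA leq_exp2l // leq_pmulr.
  have le_2B : 2 ^ 1 <= B by rewrite leq_exp2l // muln_gt0.
  by rewrite expnD -EA; move: (A) (B) le_BA le_2B; clear; lia.
- rewrite card_k.
  have le_sk : s <= 2 ^ (4 * rho * d) * 2 ^ (K + 1 + 8 * rho + rho * c).
    apply: (leq_trans le_s); rewrite -expnD.
    apply: (@leq_trans (2 ^ K * 2 ^ L.+1 * 2 ^ (rho * c))).
      apply: leq_mul; first by apply: leq_mul; apply: ltnW => //; apply: ltn_expl.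
      rewrite expnM; have [->//|c_gt0] := posnP c.
      by rewrite leq_exp2r // (leq_trans _ le_4L) // leq_pmull.
    by rewrite -!expnD leq_exp2l //; move: lt_Ld; clear; lia.
  rewrite /lam (_ : K + 2 + _ + _ = (K + 1 + 8 * rho + rho * c).+1); last by clear; lia.
  rewrite expnS; move: le_sk; set E1 := 2 ^ (4 * rho * d); set E2 := 2 ^ (K + _ + _ + _).
  have E2_gt0 : 0 < E2 by rewrite expn_gt0.
  have : E1 * t.+1 <= E1 * t.+1 * E2 by rewrite leq_pmulr.
  have : E1 * E2 <= E1 * t.+1 * E2 by rewrite leq_mul2r leq_pmulr ?orbT.
  by move: (E1) (E2); clear; lia.
(* Since [2 * h * t.+1 <= d], describing the cells takes at most half of [rho * d]; [rho >= 12]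
   leaves [6 * d] for the rest. *)
- have := leq_mul le_lam (leqnn t.+1); have := leq_mul rho_ge (leqnn d).
  have : 2 * h * t.+1 <= d by move: le_d; rewrite addn2 ltnS => /ltnW.
  move/(leq_mul (leqnn rho)); move: (lam) (h) (d_gt0); clear; lia.
- have le_td : t.+1 <= d.
    by move: le_d; rewrite addn2 ltnS => /ltnW; apply: leq_trans; rewrite leq_pmull // /h addnS.
  have := leq_mul le_w (leqnn d); have := leq_mul (leqnn (h * rho + w)) le_td.
  by have := leq_mul le_lam (leqnn t.+1); move: (2 ^ rho) (lam) (h) (d_gt0); clear; lia.
Qed.
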